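(* Let $G(V,E)$ be a graph on $n$ vertices, let $k\ge 1$, and let $G^{(1)},\ldots,G^{(k)}$ be a random $k$-partition of $G$. For any $\varepsilon\in(0,1)$, set $\lambda:=\Theta\big((\varepsilon/\log n)^2\big)$ and $\beta:=\Theta(\varepsilon^{-6}\log^{7} n)$ (for suitable absolute constants in the $\Theta$-notation). Then the algorithm that, on input $G^{(i)}$, outputs an arbitrary $\mathrm{EDCS}(G^{(i)},\beta,(1-\lambda)\beta)$ is a $(3/2+\varepsilon)$-approximation randomized composable coreset of size $O(n\cdot\beta)$ for the maximum matching problem. That is, for arbitrary choices of EDCSs $C^{(i)}$ of $G^{(i)}$ with these parameters, with high probability (over the random $k$-partition) the graph $C^{(1)}\cup\cdots\cup C^{(k)}$ contains a matching of size at least $\mathrm{MM}(G)/(3/2+\varepsilon)$, and each $C^{(i)}$ has $O(n\beta)$ edges.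
   Context: For a graph $G$, $\mathrm{MM}(G)$ denotes the size of a maximum matching of $G$, and $\deg_H(v)$ the degree of $v$ in a subgraph $H$. A random $k$-partition of $G(V,E)$ is obtained by sending each edge of $E$ independently to one of $k$ sets $E^{(1)},\ldots,E^{(k)}$ chosen uniformly at random, and letting $G^{(i)}=(V,E^{(i)})$. For parameters $\beta>\beta^-$, an edge degree constrained subgraph $\mathrm{EDCS}(G,\beta,\beta^-)$ is a subgraph $H$ of $G$ such that (P1) every edge $(u,v)\in H$ satisfies $\deg_H(u)+\deg_H(v)\le\beta$, and (P2) every edge $(u,v)\in G\setminus H$ satisfies $\deg_H(u)+\deg_H(v)\ge\beta^-$. An algorithm ALG mapping graphs to subgraphs is an $\alpha$-approximation randomized composable coreset for maximum matching if for any graph $G$ and a random $k$-partition of $G$, the maximum matching of $\mathrm{ALG}(G^{(1)})\cup\cdots\cup\mathrm{ALG}(G^{(k)})$ has size at least $\mathrm{MM}(G)/\alpha$ with high probability; its size is the number of edges of the returned subgraph. ''With high probability'' means with probability $1-1/\mathrm{poly}(n)$. *)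

(* Defs.v *)
From HB Require Import structures.
From mathcomp Require Import all_boot all_order all_algebra.
From mathcomp Require Import reals exp.

Set Implicit Arguments.
Unset Strict Implicit.
Unset Printing Implicit Defensive.

Import Order.TTheory GRing.Theory Num.Theory.
Local Open Scope ring_scope.

(* A graph on the vertex set V is given by its edge set, an edge being the
   unordered pair of its endpoints; all subgraphs keep the vertex set V. *)
Definition simple_graph (V : finType) (G : {set {set V}}) : bool :=
  [forall e in G, #|e| == 2%N].

Definition deg (V : finType) (H : {set {set V}}) (v : V) : nat :=
  #|[set e in H | v \in e]|.

Definition matching (V : finType) (G M : {set {set V}}) : bool :=
  (M \subset G) && trivIset M.

Definition MM (V : finType) (G : {set {set V}}) : nat :=
  (\max_(M : {set {set V}} | matching G M) #|M|)%N.

Definition edcs (R : realType) (V : finType) (beta beta' : R)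
    (G H : {set {set V}}) : bool :=
  [&& H \subset G,
      [forall u, forall v, ([set u; v] \in H) ==>
         ((deg H u + deg H v)%N%:R <= beta)]
    & [forall u, forall v, ([set u; v] \in G :\: H) ==>
         (beta' <= (deg H u + deg H v)%N%:R)]].

Definition kassign (V : finType) (k : nat) (G : {set {set V}}) :=
  {ffun {e : {set V} | e \in G} -> 'I_k}.

Definition part (V : finType) (k : nat) (G : {set {set V}})
    (f : kassign k G) (i : 'I_k) : {set {set V}} :=
  [set val e | e : {e : {set V} | e \in G} & f e == i].

(* Probability of the event A for a random k-partition: the parts of the edges
   are independent, each uniform over the k indices, so that the law is the
   product over the edges of the weights 1/k. *)
Definition Pr_kpartition (R : realType) (V : finType) (k : nat)
    (G : {set {set V}}) (A : pred (kassign k G)) : R :=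
  \sum_(f : kassign k G | A f)
    \prod_(e : {e : {set V} | e \in G}) (k%:R)^-1.

(* ALG G C means that C is a possible output of the algorithm on input G.  The
   outputs on the k parts are chosen adversarially, with full knowledge of the
   partition. The first conjunct (some output exists on every input) keeps the
   last one from being vacuous. *)
Definition randomized_composable_coreset (R : realType) (V : finType) (k : nat)
    (alpha delta : R) (ALG : rel {set {set V}}) : Prop :=
  [/\ forall G, simple_graph G -> exists C, ALG G C,
      forall G C, simple_graph G -> ALG G C -> C \subset G
    & forall G, simple_graph G ->
        1 - delta <=
        Pr_kpartition R (fun f : kassign k G =>
          [forall C : {ffun 'I_k -> {set {set V}}},
             [forall i, ALG (part f i) (C i)] ==>
             ((MM G)%:R / alpha <= (MM (\bigcup_i C i))%:R :> R)])].

Definition coreset_size_le (R : realType) (V : finType)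
    (ALG : rel {set {set V}}) (s : R) : Prop :=
  forall G C, simple_graph G -> ALG G C -> #|C|%:R <= s.

(* Main.v *)
Require Import Defs.
From HB Require Import structures.
From mathcomp Require Import all_boot all_order all_algebra.
From mathcomp Require Import reals sequences exp ring lra zify.

Set Implicit Arguments.
Unset Strict Implicit.
Unset Printing Implicit Defensive.

Import Order.TTheory GRing.Theory Num.Theory.
Local Open Scope ring_scope.

(* Let H be a minimiser of sum_v deg(v)^2 - 2 k beta |H| over the subgraphs of
   G: it is an EDCS of G of degree bound about k beta, and it does not depend on
   the random partition.  By Chernoff bounds deg_{H cap G_i}(v) is close to
   deg_H(v) / k for all v and i, so that H cap G_i is almost an EDCS of G_i.

   Two EDCSs A, B of one graph have close degrees: put x = deg_A - deg_B and let
   s be the gap between the two EDCS bounds.  An edge of A - B at a vertex with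
   x >= a + s leads to a vertex with x <= -a, where the degree in B - A exceeds
   that in A - B by a; so the number of edges of the difference at {|x| >= a}
   grows geometrically as a decreases, and the range of x is bounded.  This
   applies to C_i and H cap G_i for all adversarial C_i at once, and yields
   deg_{C_i}(v) ~ deg_H(v) / k; hence the union C of the C_i is an EDCS of G
   with relative slack O(eps).

   For the ratio 3/2, a random bipartition in which all edges of a maximum
   matching M of G cross halves all degrees of C up to a small error.  Take a
   Konig vertex cover K of the crossing part of C: the edges of M that avoid K
   have large degree in C, all of which goes into K, and the upper bound on the
   edge degrees then gives at most about |K| / 2 such edges. *)

Lemma sqr_sum_le (R : realFieldType) (I : finType) (A : {set I}) (f : I -> R) :
  (\sum_(i in A) f i) ^+ 2 <= #|A|%:R * \sum_(i in A) f i ^+ 2.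
Proof.
have [->|/set0Pn/card_gt0P A0] := eqVneq A set0.
  by rewrite !big_set0 mulr0 expr0n.
set S := \sum_(i in A) f i; set m : R := #|A|%:R.
have m0 : 0 < m by rewrite ltr0n.
have : 0 <= \sum_(i in A) (m * f i - S) ^+ 2.
  by apply: sumr_ge0 => i _; apply: sqr_ge0.
have -> : \sum_(i in A) (m * f i - S) ^+ 2 =
    m * (m * \sum_(i in A) f i ^+ 2 - S ^+ 2).
  transitivity (\sum_(i in A)
      (m ^+ 2 * f i ^+ 2 + - (2 * m * S) * f i + S ^+ 2)).
    by apply: eq_bigr => i _; ring.
  rewrite !big_split /= -!mulr_sumr sumr_const -/S -[_ *+ _]mulr_natl -/m; ring.
by rewrite pmulr_rge0 // subr_ge0.
Qed.

Lemma expR_le_quad (R : realType) (x : R) : x <= 1 / 2 ->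
  expR x <= 1 + x + 2 * x ^+ 2.
Proof.
move=> x2; have x1 : 0 < 1 - x by lra.
have expx : expR x * (1 - x) <= 1.
  by rewrite -ler_pdivlMl ?expR_gt0 // mulr1 -expRN expR_ge1Dx.
rewrite -(ler_pM2r x1); apply: le_trans expx _.
have : 0 <= x ^+ 2 * (1 - 2 * x) by rewrite mulr_ge0 ?sqr_ge0 //; lra.
lra.
Qed.

Lemma ln_nat_ge0 (R : realType) (n : nat) : 0 <= ln n%:R :> R.
Proof. by case: n => [|n]; [rewrite ln0 | rewrite ln_ge0 ?ler1n]. Qed.

Lemma ln_nat_ge_half (R : realType) (n : nat) : (1 < n)%N ->
  1 / 2 <= ln n%:R :> R.
Proof.
move=> n1; have ln2_le : ln 2 <= ln n%:R :> R.
  by rewrite ler_ln ?posrE ?ltr0n ?ler_nat // ltnW.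
have : ln (1 + - (1 / 2)) <= - (1 / 2) :> R by apply: le_ln1Dx; lra.
have -> : 1 + - (1 / 2) = 2^-1 :> R by field.
rewrite lnV ?posrE //; lra.
Qed.

Lemma expR_natr_mul_ln (R : realType) (n : nat) (x : R) : 0 < x ->
  expR (n%:R * ln x) = x ^+ n.
Proof. by move=> x0; rewrite expRM_natl lnK. Qed.

(** * Uniform probability on a finite type *)

Section UniformProbability.
Variables (R : realFieldType) (T : finType).
Implicit Types (X Y : T -> R) (A B : pred T).

Definition mean X : R := (\sum_t X t) / #|T|%:R.

Definition prob A : R := mean (fun t => (A t)%:R).

Lemma le_mean X Y : (forall t, X t <= Y t) -> mean X <= mean Y.
Proof. by move=> XY; rewrite ler_wpM2r ?invr_ge0 // ler_sum. Qed.

Lemma le_prob A B : (forall t, A t -> B t) -> prob A <= prob B.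
Proof.
by move=> AB; apply: le_mean => t; rewrite ler_nat; case: (A t) (AB t) => // ->.
Qed.

Lemma prob_exists_le (J : finType) (B : J -> pred T) :
  prob (fun t => [exists j, B j t]) <= \sum_j prob (B j).
Proof.
rewrite /prob /mean -mulr_suml ler_wpM2r ?invr_ge0 // exchange_big.
apply: ler_sum => t _ /=.
case: existsP => [[j Bj]|_]; last exact: sumr_ge0.
by rewrite (bigD1 j) //= Bj lerDl sumr_ge0.
Qed.

Lemma prob_orb_le A B : prob (fun t => A t || B t) <= prob A + prob B.
Proof.
rewrite /prob /mean -mulrDl ler_wpM2r ?invr_ge0 // -big_split.
apply: ler_sum => t _ /=.
by rewrite -natrD ler_nat; case: (A t); case: (B t).
Qed.

Lemma markov X (c : R) : 0 < c -> (forall t, 0 <= X t) ->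
  prob (fun t => c <= X t) <= mean X / c.
Proof.
move=> c0 X0; rewrite ler_pdivlMr // /prob /mean mulrAC ler_wpM2r ?invr_ge0 //.
rewrite mulr_suml ler_sum // => t _.
by case: (boolP (c <= X t)) => cX; rewrite ?mul1r ?mul0r.
Qed.

Lemma meanZr X (c : R) : mean (fun t => X t * c) = mean X * c.
Proof. by rewrite /mean -mulr_suml mulrAC. Qed.

Hypothesis T_gt0 : (0 < #|T|)%N.

Lemma mean_cst (c : R) : mean (fun=> c) = c.
Proof.
by rewrite /mean sumr_const -[_ *+ _]mulr_natr mulfK // pnatr_eq0 -lt0n.
Qed.

Lemma meanB X Y : mean (fun t => X t - Y t) = mean X - mean Y.
Proof. by rewrite /mean sumrB mulrBl. Qed.

Lemma probC A : prob (predC A) = 1 - prob A.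
Proof.
rewrite -[in RHS](mean_cst 1) /prob -meanB; congr (_ / _).
by apply: eq_bigr => t _ /=; case: (A t); rewrite ?subrr ?subr0.
Qed.

Lemma prob_lt1_exists A : prob A < 1 -> exists t, ~~ A t.
Proof.
move=> pA; apply/existsP; apply: contraTT pA => /existsPn nA.
by rewrite -leNgt -(mean_cst 1); apply: le_mean => t; rewrite (negPn (nA t)).
Qed.

End UniformProbability.

Lemma mean_prod (R : realFieldType) (I T : finType) (F : I -> T -> R) :
  mean (fun f : {ffun I -> T} => \prod_i F i (f i)) = \prod_i mean (F i).
Proof.
rewrite /mean prodf_div bigA_distr_bigA prodr_const; congr (_ / _).
by rewrite card_ffun natrX.
Qed.

Section ExponentialMoments.
Variables (R : realType) (T : finType).

Lemma prob_ge_le_mgf (X : T -> R) (a : R) :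
  prob R (fun t => a <= X t) <= mean (fun t => expR (X t)) / expR a.
Proof.
apply: le_trans (markov (expR_gt0 a) (fun t => expR_ge0 (X t))).
by apply: le_prob => t; rewrite ler_expR.
Qed.

Lemma subgaussian_tail (X : T -> R) (D g : R) : 0 < D -> 0 < g ->
  (forall th, `|th| <= g / (4 * D) ->
     mean (fun t => expR (th * X t)) <= expR (2 * th ^+ 2 * D)) ->
  prob R (fun t => g <= `|X t|) <= 2 * expR (- (g ^+ 2 / (8 * D))).
Proof.
move=> D0 g0 mgf; set th := g / (4 * D).
have th0 : 0 < th by rewrite divr_gt0 // mulr_gt0.
have tail c : `|c| = th ->
    prob R (fun t => th * g <= c * X t) <= expR (- (g ^+ 2 / (8 * D))).
  move=> c_th; apply: le_trans (prob_ge_le_mgf _ _) _.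
  rewrite ler_pdivrMr ?expR_gt0 // -expRD.
  apply: le_trans (mgf _ _) _; first by rewrite c_th.
  rewrite ler_expR -[c ^+ 2]real_normK ?num_real // c_th.
  by rewrite le_eqVlt; apply/predU1P; left; rewrite /th; field; rewrite gt_eqF.
have upper := tail th (gtr0_norm th0).
have lower := tail (- th) (etrans (normrN th) (gtr0_norm th0)).
rewrite mulr_natl mulr2n; apply: le_trans (lerD upper lower).
apply: le_trans (prob_orb_le _ _ _); apply: le_prob => t.
by rewrite mulNr -mulrN !ler_pM2l // lter_normr.
Qed.

End ExponentialMoments.

Section IndependentCoordinates.
Variables (R : realType) (I T : finType).

Lemma mean_expR_sum (X : I -> T -> R) :
  mean (fun f : {ffun I -> T} => expR (\sum_i X i (f i))) =
  \prod_i mean (fun t => expR (X i t)).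
Proof.
rewrite -mean_prod; congr (_ / _); apply: eq_bigr => f _; exact: expR_sum.
Qed.

Lemma mean_expR_sum_le (X : I -> T -> R) (m : I -> R) :
  (forall i, mean (fun t => expR (X i t)) <= expR (m i)) ->
  mean (fun f : {ffun I -> T} => expR (\sum_i X i (f i))) <= expR (\sum_i m i).
Proof.
move=> Xm; rewrite mean_expR_sum expR_sum; apply: ler_prod => i _.
by rewrite Xm andbT divr_ge0 ?sumr_ge0 // => t _; apply: expR_ge0.
Qed.

End IndependentCoordinates.

Section RandomSigns.
Variables (R : realType) (W : finType).
Implicit Types (b : {ffun W -> bool}) (c : W -> R).

Lemma mean_expR_sign_le (x : R) :
  mean (fun t : bool => expR (x * (-1) ^+ t)) <= expR (2 * x ^+ 2).
Proof.
rewrite /mean card_bool big_bool /= expr0 expr1 mulr1 mulrN1.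
wlog x0 : x / 0 <= x.
  move=> wlog_x; have [/wlog_x//|/ltW] := lerP 0 x.
  by rewrite -oppr_ge0 => /wlog_x; rewrite opprK sqrrN [expR x + _]addrC.
have [x2|x2] := lerP x (1 / 2).
  have := expR_le_quad x2; have := expR_ge1Dx (2 * x ^+ 2).
  have nx2 : - x <= 1 / 2 by lra.
  by have := expR_le_quad nx2; rewrite sqrrN; lra.
have : expR (- x) <= expR x by rewrite ler_expR; lra.
have : expR x <= expR (2 * x ^+ 2) by rewrite ler_expR; nra.
lra.
Qed.

Lemma mean_expR_signed_sum_le c :
  mean (fun b => expR (\sum_w c w * (-1) ^+ b w)) <=
  expR (2 * \sum_w c w ^+ 2).
Proof.
rewrite mulr_sumr.
apply: (@mean_expR_sum_le R W bool (fun w t => c w * (-1) ^+ t)) => w.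
exact: mean_expR_sign_le.
Qed.

Lemma prob_norm_signed_sum_ge c (D s : R) : 0 < D -> 0 < s ->
  \sum_w c w ^+ 2 <= D ->
  prob R (fun b => s <= `|\sum_w c w * (-1) ^+ b w|) <=
  2 * expR (- (s ^+ 2 / (8 * D))).
Proof.
move=> D0 s0 cD; apply: subgaussian_tail => // th _.
apply: (@le_trans _ _ (expR (2 * \sum_w (th * c w) ^+ 2))).
  apply: le_trans (mean_expR_signed_sum_le _); apply: le_mean => b.
  by rewrite mulr_sumr; under eq_bigr do rewrite mulrA.
under eq_bigr do rewrite exprMn.
by rewrite ler_expR -mulr_sumr mulrA ler_wpM2l // mulr_ge0 ?sqr_ge0.
Qed.

Lemma exists_balanced_signs (J : finType) (c : J -> W -> R) (D s : R) :
  0 < D -> 0 < s -> (forall j, \sum_w c j w ^+ 2 <= D) ->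
  2 * #|J|%:R * expR (- (s ^+ 2 / (8 * D))) < 1 ->
  exists b : {ffun W -> bool}, forall j, `|\sum_w c j w * (-1) ^+ b w| <= s.
Proof.
move=> D0 s0 cD small.
have [||b /existsPn good] := @prob_lt1_exists R {ffun W -> bool} _
  (fun b => [exists j, s <= `|\sum_w c j w * (-1) ^+ b w|]).
- by rewrite card_ffun card_bool expn_gt0.
- apply: le_lt_trans (prob_exists_le _ _) (le_lt_trans _ small).
  apply: (@le_trans _ _ (\sum_(j : J) 2 * expR (- (s ^+ 2 / (8 * D))))).
    by apply: ler_sum => j _; apply: prob_norm_signed_sum_ge.
  by rewrite sumr_const -[_ *+ _]mulr_natl mulrCA mulrA.
- by exists b => j; apply: ltW; rewrite ltNge.
Qed.

End RandomSigns.

Section BallsIntoBins.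
Variables (R : realType) (I T : finType).
Hypothesis T_gt0 : (0 < #|T|)%N.
Implicit Types (S : {set I}) (t : T) (f : {ffun I -> T}).

Definition load S t f : nat := #|[set x in S | f x == t]|.

Local Notation mean_load S := (#|S|%:R / #|T|%:R : R).

Let cardT_gt0 : 0 < #|T|%:R :> R. Proof. by rewrite ltr0n. Qed.

Let mean_load_ge0 S : 0 <= mean_load S. Proof. by rewrite divr_ge0. Qed.

Lemma load_sum S t f :
  (load S t f)%:R = \sum_x (x \in S)%:R * (f x == t)%:R :> R.
Proof.
rewrite /load -sum1_card natr_sum big_mkcond; apply: eq_bigr => x _.
by rewrite inE; case: (x \in S); case: (f x == t); rewrite ?mul1r ?mul0r.
Qed.

Lemma mean_expR_indicator_le (c : bool) t (th : R) :
  mean (fun u : T => expR (th * (c%:R * (u == t)%:R))) <=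
  expR (c%:R * ((expR th - 1) / #|T|%:R)).
Proof.
apply: le_trans (expR_ge1Dx _); rewrite /mean (bigD1 t) //= eqxx mulr1.
under eq_bigr => u ut do rewrite (negbTE ut) !mulr0 expR0.
rewrite sumr_const cardC1 -subn1 natrB //.
have -> : expR (th * c%:R) = 1 + c%:R * (expR th - 1).
  by case: c => /=; rewrite ?mulr1 ?mulr0 ?expR0; ring.
by rewrite le_eqVlt; apply/predU1P; left; field; rewrite (gt_eqF cardT_gt0).
Qed.

Lemma mean_expR_load_le S t (th : R) :
  mean (fun f => expR (th * (load S t f)%:R)) <=
  expR (mean_load S * (expR th - 1)).
Proof.
have -> : mean_load S * (expR th - 1) =
    \sum_x (x \in S)%:R * ((expR th - 1) / #|T|%:R).
  rewrite -mulr_suml -sum1_card natr_sum [in LHS]big_mkcond mulrAC mulrA.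
  by congr (_ * _ / _); apply: eq_bigr => x _; case: ifP.
apply: le_trans (mean_expR_sum_le _); last first.
  by move=> x; apply: mean_expR_indicator_le (x \in S) t th.
by apply: le_mean => f; rewrite load_sum mulr_sumr.
Qed.

Lemma prob_load_dev_ge S t (D g : R) : 0 < g -> g <= 2 * D ->
  mean_load S <= D ->
  prob R (fun f => g <= `|(load S t f)%:R - mean_load S|) <=
  2 * expR (- (g ^+ 2 / (8 * D))).
Proof.
move=> g0 gD pD; have D0 : 0 < D by lra.
apply: subgaussian_tail => // th th_le.
have th2 : th <= 1 / 2.
  apply: le_trans (ler_norm th) (le_trans th_le _).
  by rewrite ler_pdivrMr ?mulr_gt0 //; lra.
set p := mean_load S in pD *.
apply: (@le_trans _ _ (expR (p * (expR th - 1)) * expR (- (th * p)))).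
  apply: le_trans (ler_wpM2r (expR_ge0 _) (mean_expR_load_le S t th)).
  by rewrite -meanZr; apply: le_mean => f; rewrite -expRD mulrBr.
rewrite -expRD ler_expR.
have : p * expR th <= p * (1 + th + 2 * th ^+ 2).
  by rewrite ler_wpM2l ?expR_le_quad ?mean_load_ge0.
have : th ^+ 2 * p <= th ^+ 2 * D by rewrite ler_wpM2l ?sqr_ge0.
lra.
Qed.

(* Comparing [expR (load / 2) - 1], rather than [expR (load / 2)], with its mean
   keeps the factor [mean_load S]: it pays for a union over all the bins. *)
Lemma prob_load_ge_sparse S t (g : R) : 0 < g -> mean_load S <= 1 / 2 ->
  prob R (fun f => g <= (load S t f)%:R) <=
  2 * mean_load S / (expR (g / 2) - 1).
Proof.
set p := mean_load S => g0 p2; have p0 : 0 <= p := mean_load_ge0 S.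
have c0 : 0 < expR (g / 2) - 1 by rewrite subr_gt0 expR_gt1 divr_gt0.
pose X f : R := expR (1 / 2 * (load S t f)%:R) - 1.
have X0 f : 0 <= X f.
  by rewrite subr_ge0 -[leLHS]expR0 ler_expR mulr_ge0 // divr_ge0.
apply: le_trans (le_prob R _) (le_trans (markov c0 X0) _).
  by move=> f gf; rewrite /X lerD2r ler_expR; lra.
rewrite ler_pM2r ?invr_gt0 // meanB mean_cst ?card_ffun ?expn_gt0 ?T_gt0 //.
have e2 : expR (1 / 2) <= 2 :> R by have := @expR_le_quad R (1 / 2); lra.
have ep : expR p <= 1 + 2 * p.
  have : p * p <= p * (1 / 2) by rewrite ler_wpM2l.
  have := expR_le_quad p2; lra.
rewrite lerBlDr addrC.
apply: le_trans (mean_expR_load_le _ _ _) (le_trans _ ep).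
by rewrite ler_expR -[leRHS]mulr1 ler_wpM2l //; lra.
Qed.

Lemma prob_exists_load_dev_ge S (D g : R) :
  0 < g -> g <= 2 * D -> 8 * D <= g ^+ 2 -> mean_load S <= D ->
  prob R (fun f => [exists t, g <= `|(load S t f)%:R - mean_load S|]) <=
  4 * #|S|%:R * expR (- (g ^+ 2 / (8 * D))).
Proof.
move=> g0 gD Dg pD; set y := g ^+ 2 / (8 * D); have D0 : 0 < D by lra.
have g4 : 4 <= g by rewrite -(ler_pM2r g0); lra.
have cardS : #|S|%:R = mean_load S * #|T|%:R.
  by rewrite divfK // (gt_eqF cardT_gt0).
apply: le_trans (prob_exists_le _ _) _.
have [sparse|dense] := lerP (mean_load S) (1 / 2); last first.
  apply: le_trans (ler_sum _ (fun t _ => prob_load_dev_ge t g0 gD pD)) _.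
  rewrite sumr_const -[_ *+ _]mulr_natl mulrA ler_wpM2r ?expR_ge0 //.
  rewrite cardS mulrA mulrC ler_pM2r //; lra.
have y_g : y <= g / 2.
  rewrite /y ler_pdivrMr ?mulr_gt0 // expr2.
  have : g * g <= g * (2 * D) by rewrite ler_pM2l.
  have : 0 <= g * D by rewrite mulr_ge0 // ltW.
  lra.
have e_half : expR y / 2 <= expR (g / 2) - 1.
  have := expR_ge1Dx (g / 2); have : expR y <= expR (g / 2) by rewrite ler_expR.
  lra.
have bound t : prob R (fun f => g <= `|(load S t f)%:R - mean_load S|) <=
    4 * mean_load S * expR (- y).
  apply: le_trans (le_prob R _) (le_trans (prob_load_ge_sparse t g0 sparse) _).
    move=> f; have := mean_load_ge0 S; have := ler0n R (load S t f).
    by rewrite lter_normr => load_ge0 mean_ge0 /orP [] => g_le; lra.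
  rewrite ler_pdivrMr; last by have := expR_gt0 y; lra.
  have -> : 2 * mean_load S = 4 * mean_load S * expR (- y) * (expR y / 2).
    by rewrite expRN; field; rewrite expR_eq0 gt_eqF.
  by rewrite ler_wpM2l // !mulr_ge0 ?invr_ge0 ?expR_ge0.
apply: le_trans (ler_sum _ (fun t _ => bound t)) _.
rewrite sumr_const -[_ *+ _]mulr_natl mulrA ler_pM2r ?expR_gt0 //.
by rewrite [in leRHS]cardS mulrC -mulrA.
Qed.

End BallsIntoBins.

(** * Graphs and edge degree constrained subgraphs *)

Section Graphs.
Variable V : finType.
Implicit Types (G H F M : {set {set V}}) (e : {set V}) (u v : V).

Lemma simple_graphS G H : H \subset G -> simple_graph G -> simple_graph H.
Proof.
by move=> sHG /forall_inP sG; apply/forall_inP => e /(subsetP sHG)/sG.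
Qed.

Lemma simple_edge_end G e v : simple_graph G -> e \in G -> v \in e ->
  exists2 u, u != v & e = [set v; u].
Proof.
move=> /forall_inP sG /sG /cards2P [a] [b] [ab ->].
rewrite !inE => /orP [] /eqP ->; first by exists b => //; rewrite eq_sym.
by exists a => //; rewrite setUC.
Qed.

Lemma simple_edgeP G e : simple_graph G -> e \in G ->
  exists u v, u != v /\ e = [set u; v].
Proof. by move=> /forall_inP sG /sG /cards2P [a [b [ab ->]]]; exists a, b. Qed.

Lemma simple_edge_eq G e u v : simple_graph G -> e \in G ->
  u \in e -> v \in e -> u != v -> e = [set u; v].
Proof.
move=> sG eG ue; have [w wu ->] := simple_edge_end sG eG ue.
by rewrite !inE eq_sym => /orP [->//|/eqP ->].
Qed.

Lemma simple_edge_neq G u v : simple_graph G -> [set u; v] \in G -> u != v.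
Proof. by move=> /forall_inP sG /sG; rewrite cards2; case: (u != v). Qed.

Lemma simple_graph_set0 G : (#|V| <= 1)%N -> simple_graph G -> G = set0.
Proof.
move=> V1 /forall_inP sG; apply/setP => e; rewrite inE.
apply/negP => /sG/eqP e2.
by have := max_card e; rewrite e2 leqNgt ltnS V1.
Qed.

Lemma deg_sum_mem H v : deg H v = (\sum_(e in H) (v \in e))%N.
Proof.
rewrite /deg -sum1_card big_mkcond [RHS]big_mkcond; apply: eq_bigr => e _.
by rewrite inE; case: (e \in H); case: (v \in e).
Qed.

Lemma deg_card_adj H v : simple_graph H ->
  deg H v = #|[set u | [set v; u] \in H]|.
Proof.
move=> sH; rewrite -(card_in_imset (f := fun u => [set v; u])); last first.
  move=> u w; rewrite !inE => /(simple_edge_neq sH) vu _ /setP/(_ u).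
  by rewrite !inE eqxx orbT eq_sym (negbTE vu) => /esym/eqP.
apply: eq_card => e; rewrite inE; apply/andP/imsetP => [[eH ve]|[u + ->]].
  by have [u _ eE] := simple_edge_end sH eH ve; exists u; rewrite // inE -eE.
by rewrite inE set21.
Qed.

Lemma deg_sum_adj H v : simple_graph H ->
  deg H v = (\sum_u ([set v; u] \in H))%N.
Proof.
move=> sH; rewrite deg_card_adj // -sum1_card big_mkcond; apply: eq_bigr => u _.
by rewrite inE; case: ifP.
Qed.

Lemma deg_le_card H v : simple_graph H -> (deg H v <= #|V|)%N.
Proof. by move=> sH; rewrite deg_card_adj // max_card. Qed.

Lemma degS G H v : H \subset G -> (deg H v <= deg G v)%N.
Proof. by move=> sHG; rewrite subset_leq_card // !setIdE setSI. Qed.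

Lemma degID F H v : (deg (H :&: F) v + deg (H :\: F) v = deg H v)%N.
Proof. by rewrite !deg_sum_mem [RHS](big_setID F). Qed.

Lemma deg_gt0 H v : simple_graph H -> (0 < deg H v)%N ->
  exists u, [set v; u] \in H.
Proof.
by move=> sH; rewrite deg_card_adj // => /card_gt0P [u]; rewrite inE; exists u.
Qed.

Lemma deg_setU1 H e v : e \notin H -> deg (e |: H) v = ((v \in e) + deg H v)%N.
Proof. by move=> eH; rewrite !deg_sum_mem big_setU1. Qed.

Lemma deg_bigcup (I : finType) (C : I -> {set {set V}}) v :
  (forall i j, i != j -> [disjoint C i & C j]) ->
  deg (\bigcup_i C i) v = (\sum_i deg (C i) v)%N.
Proof.
move=> disjC; rewrite deg_sum_mem partition_disjoint_bigcup //.
by apply: eq_bigr => i _; rewrite deg_sum_mem.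
Qed.

Lemma sum_deg H : simple_graph H -> (\sum_v deg H v = 2 * #|H|)%N.
Proof.
move=> /forall_inP sH; under eq_bigr do rewrite deg_sum_mem.
rewrite exchange_big -sum1_card big_distrr /=; apply: eq_bigr => e /sH/eqP <-.
rewrite muln1 -sum1_card [RHS]big_mkcond; apply: eq_bigr => v _.
by case: (v \in e).
Qed.

Lemma leq_card_MM G M : matching G M -> (#|M| <= MM G)%N.
Proof. exact: (@leq_bigmax_cond _ (matching G) (fun M => #|M|)). Qed.

Lemma matchingS G H M : H \subset G -> matching H M -> matching G M.
Proof. by move=> sHG /andP [sMH tM]; rewrite /matching (subset_trans sMH). Qed.

Lemma maximum_matching G : exists2 M, matching G M & #|M| = MM G.
Proof.
have m0 : (0 < #|matching G|)%N.
  apply/card_gt0P; exists set0; rewrite unfold_in /matching sub0set.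
  by apply/trivIsetP => A B; rewrite inE.
by rewrite /MM; have [M mM ->] := eq_bigmax_cond (fun M => #|M|) m0; exists M.
Qed.

Lemma MMS G H : H \subset G -> (MM H <= MM G)%N.
Proof.
move=> sHG; have [M mM <-] := maximum_matching H.
exact: leq_card_MM (matchingS sHG mM).
Qed.

Lemma MM_set0 : MM (set0 : {set {set V}}) = 0%N.
Proof.
have [M /andP [] ] := maximum_matching set0.
by rewrite subset0 => /eqP -> _; rewrite cards0.
Qed.

Lemma card_cover_matching G M : simple_graph G -> matching G M ->
  #|cover M| = (2 * #|M|)%N.
Proof.
move=> /forall_inP sG /andP [/subsetP sMG tM].
rewrite -sum1_card big_trivIset // -sum1_card big_distrr /=.
by apply: eq_bigr => e /sMG; rewrite sum1_card => /sG /eqP.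
Qed.

Lemma deg_matching_le1 G M v : matching G M -> (deg M v <= 1)%N.
Proof.
case/andP => _ /trivIsetP tM; apply/card_le1_eqP => e f; rewrite !inE.
case/andP => eM ve /andP [fM vf]; apply/eqP; apply: contraT => ef.
by rewrite -(disjointFr (tM _ _ fM eM ef) vf).
Qed.

End Graphs.

Section Edcs.
Variables (R : realType) (V : finType).
Implicit Types (b c t : R) (G H F : {set {set V}}) (u v : V).

Lemma edcsP b c G H :
  reflect [/\ H \subset G,
    forall u v, [set u; v] \in H -> (deg H u)%:R + (deg H v)%:R <= b
  & forall u v, [set u; v] \in G -> [set u; v] \notin H ->
      c <= (deg H u)%:R + (deg H v)%:R] (edcs b c G H).
Proof.
apply: (iffP and3P) => [] [sHG upper lower]; split=> //.
- move=> u v uvH; have /forallP/(_ v)/implyP := forallP upper u.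
  by rewrite natrD; apply.
- move=> u v uvG uvH; have /forallP/(_ v)/implyP := forallP lower u.
  by rewrite natrD inE uvH uvG; apply.
- apply/forallP => u; apply/forallP => v; apply/implyP => /upper.
  by rewrite natrD.
- apply/forallP => u; apply/forallP => v; apply/implyP.
  by rewrite natrD inE => /andP [uvH uvG]; apply: lower.
Qed.

Lemma edcs_sub b c G H : edcs b c G H -> H \subset G.
Proof. by case/edcsP. Qed.

Lemma edcsW b b' c c' G H : b <= b' -> c' <= c -> edcs b c G H ->
  edcs b' c' G H.
Proof.
move=> bb' c'c /edcsP [sHG upper lower]; apply/edcsP; split=> // u v.
  by move/upper/le_trans; apply.
by move=> uvG /(lower _ _ uvG); apply: le_trans.
Qed.

Lemma edcs_deg_le b c G H v : simple_graph G -> 0 <= b -> edcs b c G H ->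
  (deg H v)%:R <= b.
Proof.
move=> sG b0 /edcsP [sHG upper _]; have [->//|] := posnP (deg H v).
case/(deg_gt0 (simple_graphS sHG sG)) => u /upper; apply: le_trans.
by rewrite lerDl.
Qed.

Lemma edcs_card_le b c G H : simple_graph G -> 0 <= b -> edcs b c G H ->
  #|H|%:R <= #|V|%:R * b.
Proof.
move=> sG b0 eH; have sH := simple_graphS (edcs_sub eH) sG.
apply: (@le_trans _ _ (\sum_v (deg H v)%:R)).
  by rewrite -natr_sum sum_deg // ler_nat leq_pmull.
rewrite mulr_natl -sumr_const; apply: ler_sum => v _.
exact: edcs_deg_le sG b0 eH.
Qed.

Definition edcs_potential t H : R := \sum_v (deg H v)%:R ^+ 2 - 2 * t * #|H|%:R.

Lemma edcs_potential_setU1 t F u v : u != v -> [set u; v] \notin F ->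
  edcs_potential t ([set u; v] |: F) =
  edcs_potential t F + 2 * ((deg F u)%:R + (deg F v)%:R + 1 - t).
Proof.
move=> uv eF; rewrite /edcs_potential cardsU1 eF natrD.
have -> : \sum_w (deg ([set u; v] |: F) w)%:R ^+ 2 =
    \sum_w (deg F w)%:R ^+ 2 +
    \sum_(w in [set u; v]) (2 * (deg F w)%:R + 1) :> R.
  rewrite [X in _ + X]big_mkcond -big_split; apply: eq_bigr => w _ /=.
  by rewrite deg_setU1 // natrD; case: (w \in _) => /=; ring.
by rewrite big_setU1 ?inE //= big_set1; ring.
Qed.

(* Inserting or deleting one edge cannot lower the potential of a minimiser. *)
Lemma edcs_exists t G : simple_graph G -> exists H, edcs (t + 1) (t - 1) G H.
Proof.
move=> sG; have [H sHG minH] := @Order.TotalTheory.arg_minP _ _ _ set0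
  (fun H => H \subset G) (edcs_potential t) (sub0set G).
exists H; apply/edcsP; split=> // u v.
  move=> uvH; have uv := simple_edge_neq (simple_graphS sHG sG) uvH.
  pose F := H :\ [set u; v]; have HE : [set u; v] |: F = H := setD1K uvH.
  have := minH F (subset_trans (subsetDl _ _) sHG).
  rewrite -HE edcs_potential_setU1 ?setD11 // !deg_setU1 ?setD11 //.
  rewrite set21 set22 !natrD /=; lra.
move=> uvG uvH; have uv := simple_edge_neq sG uvG.
have := minH ([set u; v] |: H); rewrite subUset sub1set uvG sHG => /(_ isT).
rewrite edcs_potential_setU1 //; lra.
Qed.

End Edcs.

(** * Two EDCSs of one graph have close degrees *)

Section DegreeGap.
Variables (R : realType) (V : finType).
Implicit Types (A B G P : {set {set V}}) (u v : V).

Definition deg_gap A B v : R := (deg A v)%:R - (deg B v)%:R.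

Definition gap_mass A B (a : R) : R :=
  \sum_(v | a <= deg_gap A B v) (deg (A :\: B) v)%:R.

Lemma deg_gapC A B v : deg_gap B A v = - deg_gap A B v.
Proof. by rewrite /deg_gap opprB. Qed.

Lemma deg_gap_setD A B v :
  deg_gap A B v = (deg (A :\: B) v)%:R - (deg (B :\: A) v)%:R.
Proof. by rewrite /deg_gap -(degID B A) -(degID A B) setIC !natrD; ring. Qed.

Lemma gap_mass_le A B (a : R) : simple_graph A ->
  gap_mass A B a <= #|V|%:R ^+ 2.
Proof.
move=> sA; apply: (@le_trans _ _ (\sum_(v : V) #|V|%:R)).
  rewrite /gap_mass big_mkcond; apply: ler_sum => v _; case: ifP => // _.
  by rewrite ler_nat deg_le_card // (simple_graphS (subsetDl A B)).
by rewrite sumr_const -[_ *+ _]mulr_natr expr2.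
Qed.

Lemma gap_mass_ge1 A B (a : R) v : 0 < a -> a <= deg_gap A B v ->
  1 <= gap_mass A B a.
Proof.
move=> a0 av; rewrite /gap_mass (bigD1 v) //=.
have : 1 <= (deg (A :\: B) v)%:R :> R.
  rewrite ler1n -(ltr_nat R); apply: lt_le_trans a0 (le_trans av _).
  by rewrite deg_gap_setD gerBl.
by move/le_trans; apply; rewrite lerDl sumr_ge0.
Qed.

Lemma sum_deg_across P (x : V -> R) (a s : R) : simple_graph P ->
  (forall u v, [set u; v] \in P -> x u + x v <= s) ->
  \sum_(v | a <= x v) (deg P v)%:R <= \sum_(v | x v <= s - a) (deg P v)%:R :> R.
Proof.
move=> sP xP.
under eq_bigr do rewrite deg_sum_adj // natr_sum.
under [leRHS]eq_bigr do rewrite deg_sum_adj // natr_sum.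
rewrite exchange_big [leRHS]big_mkcond; apply: ler_sum => u _ /=.
rewrite big_mkcond; case: ifP => us.
  by apply: ler_sum => v _; rewrite setUC; case: ifP.
rewrite big1 // => v _; case: ifP => // av; case: (boolP (_ \in P)) => // /xP.
lra.
Qed.

Lemma edcs_gap_edge (b c : R) G A B u v : edcs b c G A -> edcs b c G B ->
  [set u; v] \in A :\: B -> deg_gap A B u + deg_gap A B v <= b - c.
Proof.
move=> /edcsP [sAG upper _] /edcsP [_ _ lower]; rewrite inE => /andP [uvB uvA].
have := upper _ _ uvA; have := lower _ _ (subsetP sAG _ uvA) uvB.
rewrite /deg_gap; lra.
Qed.

Section TwoEdcs.
Variables (b c h : R) (G : {set {set V}}).
Hypotheses (sG : simple_graph G) (b0 : 0 < b) (cb : c <= b) (h0 : 0 < h).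

(* An edge of [A :\: B] at a vertex where [A] exceeds [B] by [a + (b - c)] leads
   to a vertex where [B] exceeds [A] by [a]. *)
Lemma gap_mass_step A B (a : R) : edcs b c G A -> edcs b c G B -> h <= a ->
  gap_mass A B (a + (b - c)) <= gap_mass B A a * expR (- (h / b)).
Proof.
move=> eA eB ha.
have sAB : simple_graph (A :\: B).
  by apply: simple_graphS sG; apply: subset_trans (subsetDl _ _) (edcs_sub eA).
apply: le_trans (sum_deg_across _ sAB (fun u v => edcs_gap_edge eA eB)) _.
rewrite /gap_mass mulr_suml (eq_bigl (fun v => a <= deg_gap B A v)); last first.
  by move=> v; rewrite deg_gapC; apply/idP/idP; lra.
apply: ler_sum => v av; set d : R := (deg (B :\: A) v)%:R.
have db : d <= b.
  apply: le_trans (edcs_deg_le v sG (ltW b0) eB).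
  by rewrite ler_nat degS ?subsetDl.
apply: (@le_trans _ _ (d - h)).
  by have := av; rewrite deg_gap_setD -/d; lra.
apply: (@le_trans _ _ (d * (1 - h / b))); last by rewrite ler_wpM2l ?expR_ge1Dx.
rewrite mulrBr mulr1 lerD2l lerN2 mulrCA ler_piMr ?(ltW h0) //.
by rewrite ler_pdivrMr // mul1r.
Qed.

Lemma gap_mass_iter A B (j : nat) : edcs b c G A -> edcs b c G B ->
  gap_mass A B (h + j%:R * (b - c)) <= #|V|%:R ^+ 2 * expR (- (j%:R * (h / b))).
Proof.
elim: j A B => [|j IHj] A B eA eB.
  rewrite !mul0r oppr0 expR0 addr0 mulr1; apply: gap_mass_le.
  exact: simple_graphS (edcs_sub eA) sG.
rewrite -natr1 !mulrDl !mul1r addrA opprD expRD mulrA.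
apply: le_trans (gap_mass_step eA eB _) _.
  by rewrite lerDl mulr_ge0 // subr_ge0.
by rewrite ler_wpM2r ?expR_ge0 // IHj.
Qed.

Lemma edcs_deg_gap_lt A B (j : nat) v : edcs b c G A -> edcs b c G B ->
  #|V|%:R ^+ 2 * expR (- (j%:R * (h / b))) < 1 ->
  deg_gap A B v < h + j%:R * (b - c).
Proof.
move=> eA eB small; rewrite ltNge; apply/negP => /gap_mass_ge1.
have h_gt0 : 0 < h + j%:R * (b - c) by rewrite ltr_wpDr // mulr_ge0 // subr_ge0.
move=> /(_ h_gt0); apply/negP; rewrite -ltNge.
exact: le_lt_trans (gap_mass_iter j eA eB) small.
Qed.

(* The mass decays by [expR (- (h / b))] at each step of length [b - c], hence
   it is below one, i.e. zero, after [2 * ln #|V| * b / h] steps. *)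
Lemma edcs_deg_gap_le A B v : edcs b c G A -> edcs b c G B ->
  2 * ln #|V|%:R * b * (b - c) <= h ^+ 2 ->
  `|deg_gap A B v| <= 2 * h + (b - c).
Proof.
move=> eA eB hb; set L : R := ln #|V|%:R in hb.
have V0 : 0 < #|V|%:R :> R by rewrite ltr0n; apply/card_gt0P; exists v.
have L0 : 0 <= L := ln_nat_ge0 R _.
pose j := (Num.truncn (2 * L * b / h)).+1.
have [j_le j_gt] : j%:R <= 2 * L * b / h + 1 /\ 2 * L * b / h < j%:R.
  split; last exact: truncnS_gt.
  by rewrite -[j%:R]natr1 lerD2r truncn_le divr_ge0 ?mulr_ge0 // ltW.
have small : #|V|%:R ^+ 2 * expR (- (j%:R * (h / b))) < 1.
  rewrite -(expR_natr_mul_ln _ V0) -/L -expRD.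
  by rewrite expR_lt1 subr_lt0 mulrA ltr_pdivlMr // -ltr_pdivrMr.
have steps : h + j%:R * (b - c) <= 2 * h + (b - c).
  have := ler_wpM2r (_ : 0 <= b - c) j_le; rewrite subr_ge0 => /(_ cb).
  rewrite mulrDl mul1r; have : 2 * L * b / h * (b - c) <= h.
    by rewrite mulrAC ler_pdivrMr // -expr2.
  lra.
have := edcs_deg_gap_lt v eA eB small; have := edcs_deg_gap_lt v eB eA small.
by rewrite deg_gapC ler_norml => gBA gAB; apply/andP; split; lra.
Qed.

End TwoEdcs.
End DegreeGap.

(** * Vertex covers and bipartite EDCSs *)

Section VertexCover.
Variable V : finType.
Implicit Types (F H M : {set {set V}}) (K : {set V}) (side : pred V).
Implicit Types (u v : V).

Definition vcover K H : bool := [forall e in H, ~~ [disjoint e & K]].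

Definition bipartite side H : Prop :=
  forall u v, [set u; v] \in H -> side u != side v.

Lemma vcoverP K H :
  reflect (forall e, e \in H -> exists2 v, v \in e & v \in K) (vcover K H).
Proof.
apply: (iffP forall_inP) => cK e /cK.
  by case/pred0Pn => v /andP [ve vK]; exists v.
by case=> v ve vK; apply/pred0Pn; exists v; rewrite /= ve.
Qed.

Lemma vcover_edge K H u v : vcover K H -> [set u; v] \in H ->
  (u \in K) || (v \in K).
Proof.
move=> /vcoverP cK /cK [w].
by rewrite !inE => /orP [] /eqP -> ->; rewrite ?orbT.
Qed.

Lemma bipartiteS side F H : F \subset H -> bipartite side H -> bipartite side F.
Proof. by move=> /subsetP sFH bip u v /sFH/bip. Qed.

Lemma trivIset_leq_vcover M K : trivIset M -> vcover K M -> (#|M| <= #|K|)%N.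
Proof.
move=> tM /vcoverP cK; apply: (@leq_trans (\sum_(v in cover M) (v \in K))).
  rewrite big_trivIset //= -sum1_card; apply: leq_sum => e /cK [v ve vK].
  by rewrite (bigD1 v) //= vK.
rewrite -sum1_card big_mkcond [leqRHS]big_mkcond; apply: leq_sum => v _.
by case: ifP => _; case: ifP.
Qed.

Lemma trivIset_leq_card_avoid M K : trivIset M ->
  (#|M| <= #|[set e in M | [disjoint e & K]]| + #|K|)%N.
Proof.
move=> tM; rewrite -(cardsID [set e : {set V} | [disjoint e & K]] M).
rewrite setIdE leq_add2l; apply: trivIset_leq_vcover; first exact: trivIsetD.
by apply/forall_inP => e; rewrite !inE => /andP [].
Qed.

Lemma exists_vcover_leq_card H : simple_graph H ->
  exists2 K, vcover K H & (#|K| <= #|H|)%N.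
Proof.
move=> sH; have [->|[e0 /(simple_edgeP sH) [x0 _]]] := set_0Vmem H.
  by exists set0; rewrite ?cards0 //; apply/vcoverP => e; rewrite inE.
pose f (e : {set V}) := odflt x0 [pick v in e].
exists (f @: H); last exact: leq_imset_card.
apply/vcoverP => e eH; exists (f e); last exact: imset_f.
have [u [v [_ eE]]] := simple_edgeP sH eH.
by rewrite /f; case: pickP => // /(_ u); rewrite eE set21.
Qed.

Lemma vcoverD1 K F e v : vcover K (F :\ e) -> v \in e -> v \in K -> vcover K F.
Proof.
move=> /vcoverP cK ve vK; apply/vcoverP => g gF.
by have [->|ge] := eqVneq g e; [exists v | apply: cK; rewrite !inE ge].
Qed.

Definition mix_cover side K1 K2 : {set V} :=
  [set v | if side v then (v \in K1) || (v \in K2)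
           else (v \in K1) && (v \in K2)].

Lemma card_mix_cover side K1 K2 :
  (#|mix_cover side K1 K2| + #|mix_cover (predC side) K1 K2| = #|K1| + #|K2|)%N.
Proof.
have cardE K : #|K| = (\sum_v (v \in K))%N.
  by rewrite -sum1_card big_mkcond; apply: eq_bigr => v _; case: ifP.
rewrite !cardE -!big_split; apply: eq_bigr => v _; rewrite /= !inE /=.
by case: (side v); case: (v \in K1); case: (v \in K2).
Qed.

Lemma vcover_mix side F1 F2 K1 K2 : simple_graph F1 -> bipartite side F1 ->
  vcover K1 F1 -> vcover K2 F2 -> vcover (mix_cover side K1 K2) (F1 :&: F2).
Proof.
move=> sF bip cK1 cK2; apply/vcoverP => e /setIP [e1].
have [u [v [_ eE]]] := simple_edgeP sF e1; rewrite eE in e1 * => uv2.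
have := bip _ _ e1; have := vcover_edge cK1 e1; have := vcover_edge cK2 uv2.
have [u1|u1] := boolP (u \in mix_cover side K1 K2).
  by exists u; rewrite ?set21.
move=> uv2K uv1K side_uv; exists v; rewrite ?set22 //.
move: u1 uv1K uv2K side_uv; rewrite !inE.
by do 2!case: (side _); do 4!case: (_ \in _).
Qed.

Section EdgesThroughVertex.
Variables (F : {set {set V}}) (e f : {set V}) (x : V) (K1 K2 : {set V}).
Hypotheses (sF : simple_graph F) (eF : e \in F) (fF : f \in F) (ef : e != f).
Hypotheses (xe : x \in e) (xf : x \in f).
Hypotheses (cK1 : vcover K1 (F :\ e)) (cK2 : vcover K2 (F :\ f)).

Lemma vcover_mix_other side g : bipartite side F ->
  g \in F -> g != e -> g != f ->
  exists2 v, v \in g & v \in mix_cover side K1 K2.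
Proof.
move=> bip gF ge gf; have sFe := simple_graphS (subsetDl F [set e]) sF.
have bipFe := bipartiteS (subsetDl F [set e]) bip.
apply: (vcoverP _ _ (vcover_mix sFe bipFe cK1 cK2)).
by rewrite !inE ge gf gF.
Qed.

Lemma vcover_setU1_mix side : bipartite side F ->
  vcover (x |: mix_cover side K1 K2) F.
Proof.
move=> bip; apply/vcoverP => g gF.
have [->|ge] := eqVneq g e; first by exists x; rewrite ?setU11.
have [->|gf] := eqVneq g f; first by exists x; rewrite ?setU11.
have [v vg vK] := vcover_mix_other bip gF ge gf.
by exists v; rewrite // setU1r.
Qed.

Lemma vcover_mix_opposite side : bipartite side F -> ~~ side x ->
  x \notin K1 -> x \notin K2 -> vcover (mix_cover side K1 K2) F.
Proof.
move=> bip sx x1 x2.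
have opposite g K v : g \in F -> x \in g -> x \notin K ->
    v \in g -> v \in K -> side v.
  move=> gF xg xK vg vK; have vx : x != v by apply: contraNneq xK => ->.
  have := gF; rewrite (simple_edge_eq sF gF xg vg vx) => /bip.
  by rewrite (negbTE sx); case: (side v).
apply/vcoverP => g gF; have [ge|ge] := eqVneq g e.
  have [|v vg v2] := vcoverP _ _ cK2 g; first by rewrite !inE ge ef eF.
  by exists v; rewrite // inE (opposite g K2) ?v2 ?orbT // ge.
have [gf|gf] := eqVneq g f; last exact: vcover_mix_other.
have [|v vg v1] := vcoverP _ _ cK1 g; first by rewrite !inE ge gF.
by exists v; rewrite // inE (opposite g K1) ?v1 // gf.
Qed.

End EdgesThroughVertex.

(* Two edges through [x] whose removal allows covers [K1], [K2] below [t] would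
   give covers [mix_cover] and [x |: mix_cover] of total size below [2 * t]. *)
Lemma vcover_critical_trivIset side F (t : nat) :
  simple_graph F -> bipartite side F ->
  (forall K, vcover K F -> (t <= #|K|)%N) ->
  (forall e, e \in F -> exists2 K, vcover K (F :\ e) & (#|K| < t)%N) ->
  trivIset F.
Proof.
move=> sF bip coverF critF; apply/trivIsetP => e f eF fF ef.
apply/pred0P => x /=; apply/negP => /andP [xe xf].
have bipC : bipartite (predC side) F.
  by move=> u v /bip; rewrite /= (inj_eq negb_inj).
wlog sx : side bip bipC / ~~ side x.
  move=> wlog_x; have [sx|] := boolP (side x); last exact: wlog_x.
  apply: (wlog_x (predC side)) => //; last by rewrite /= negbK.
  by move=> u v /bip; rewrite /= !negbK.
have [K1 cK1 K1t] := critF _ eF; have [K2 cK2 K2t] := critF _ fF.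
have x1 : x \notin K1.
  by apply: contraL K1t => xK; rewrite -leqNgt coverF // (vcoverD1 cK1 xe).
have x2 : x \notin K2.
  by apply: contraL K2t => xK; rewrite -leqNgt coverF // (vcoverD1 cK2 xf).
move: (coverF _ (vcover_mix_opposite sF eF ef xe xf cK1 cK2 bip sx x1 x2)).
move: (coverF _ (vcover_setU1_mix sF xe xf cK1 cK2 bipC)) K1t K2t.
move: (card_mix_cover side K1 K2); rewrite cardsU1.
by case: (x \notin _); clear; lia.
Qed.

Lemma konig side H : simple_graph H -> bipartite side H ->
  exists2 K, vcover K H & (#|K| <= MM H)%N.
Proof.
move=> sH bip.
have cT : vcover setT H.
  apply/vcoverP => e /(simple_edgeP sH) [u [v [_ ->]]].
  by exists u; rewrite ?set21 ?inE.
have [K cK minK] := @arg_minnP _ setT (vcover^~ H) (fun K => #|K|) cT.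
pose tight F := (F \subset H) && [forall K', vcover K' F ==> (#|K| <= #|K'|)%N].
have tightH : tight H by rewrite /tight subxx; apply/forall_inP => K' /minK.
have [F /andP [sFH /forall_inP tF] minF] := arg_minnP (fun F => #|F|) tightH.
have sF := simple_graphS sFH sH.
have matchF : matching H F.
  rewrite /matching sFH.
  apply: (vcover_critical_trivIset sF (bipartiteS sFH bip) tF).
  move=> e eF; have : ~~ tight (F :\ e).
    by apply: contraL eF => /minF; rewrite (cardsD1 e F); case: (e \in F); lia.
  rewrite /tight (subset_trans (subsetDl _ _) sFH) => /forall_inPn [K' cK'].
  by rewrite -ltnNge; exists K'.
have [K' cK' K'F] := exists_vcover_leq_card sF.
exists K => //.
by apply: leq_trans (tF _ cK') (leq_trans K'F (leq_card_MM matchF)).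
Qed.

End VertexCover.

Section BipartiteEdcs.
Variables (R : realType) (V : finType).
Implicit Types (G H M : {set {set V}}) (K X : {set V}) (side : pred V).
Implicit Types (u v w : V).

Section IndependentSet.
Variables (b : R) (H : {set {set V}}) (K X : {set V}).
Hypotheses (sH : simple_graph H) (cK : vcover K H) (dXK : [disjoint X & K]).
Hypothesis upper :
  forall u v, [set u; v] \in H -> (deg H u)%:R + (deg H v)%:R <= b.

Local Notation adj u w := (([set u; w] \in H)%:R : R).

Lemma deg_adj_vcover u : u \in X -> (deg H u)%:R = \sum_(w in K) adj u w.
Proof.
move=> uX; rewrite deg_sum_adj // natr_sum [RHS]big_mkcond.
apply: eq_bigr => w _; case: ifPn => // wK.
case: (boolP (_ \in H)) => // /(vcover_edge cK).
by rewrite (negbTE wK) (disjointFr dXK uX).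
Qed.

Lemma sum_sqr_deg_le :
  \sum_(u in X) (deg H u)%:R ^+ 2 +
    \sum_(w in K) (\sum_(u in X) adj u w) ^+ 2 <=
  b * \sum_(u in X) (deg H u)%:R.
Proof.
have -> : \sum_(w in K) (\sum_(u in X) adj u w) ^+ 2 =
    \sum_(u in X) \sum_(w in K) adj u w * \sum_(u' in X) adj u' w.
  by rewrite exchange_big; apply: eq_bigr => w _; rewrite -mulr_suml expr2.
rewrite mulr_sumr -big_split; apply: ler_sum => u uX /=.
rewrite expr2 {1 3}deg_adj_vcover // mulr_suml mulr_sumr -big_split.
apply: ler_sum => w _ /=.
case: (boolP (_ \in H)) => [uw|_]; last by rewrite mulr0 !mul0r addr0.
rewrite !mul1r mulr1; apply: le_trans (upper uw).
rewrite lerD2l deg_sum_adj // natr_sum [leRHS](bigID (mem X)) /=.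
by under eq_bigr do rewrite setUC; rewrite lerDl sumr_ge0.
Qed.

Lemma sum_deg_vcover_le : 0 <= b ->
  (\sum_(u in X) (deg H u)%:R) * (#|X|%:R + #|K|%:R) <= b * #|X|%:R * #|K|%:R.
Proof.
move=> b0; have sqrs := sum_sqr_deg_le.
have sqrX := sqr_sum_le X (fun u => (deg H u)%:R : R).
have sqrK := sqr_sum_le K (fun w => \sum_(u in X) adj u w).
rewrite exchange_big -(eq_bigr _ deg_adj_vcover) in sqrK.
set N := \sum_(u in X) _ in sqrs sqrX sqrK *.
set SX := \sum_(u in X) _ in sqrs sqrX; set SK := \sum_(w in K) _ in sqrs sqrK.
set x : R := #|X|%:R in sqrX *; set k : R := #|K|%:R in sqrK *.
have [x0 k0] : 0 <= x /\ 0 <= k by [].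
have := sumr_ge0 _ (fun u _ => ler0n R (deg H u)) : 0 <= N.
rewrite le_eqVlt => /predU1P [<-|N0]; first by rewrite mul0r !mulr_ge0.
rewrite -(ler_pM2l N0).
have : k * N ^+ 2 <= k * (x * SX) by rewrite ler_wpM2l.
have : x * N ^+ 2 <= x * (k * SK) by rewrite ler_wpM2l.
have : x * k * (SX + SK) <= x * k * (b * N) by rewrite ler_wpM2l // mulr_ge0.
lra.
Qed.

End IndependentSet.

(* The edges of [M] avoiding the cover have large degree, all of which goes into
   the cover. *)
Lemma edcs_matching_le_vcover (b c : R) G H M K :
  simple_graph G -> edcs b c G H -> matching G M -> vcover K H ->
  0 < c -> c <= 2 * b -> c * (2 * #|M|%:R - #|K|%:R) <= 2 * b * #|K|%:R.
Proof.
move=> sG eH /andP [sMG tM] cK c0 cb.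
have [sHG upper lower] := edcsP _ _ _ _ eH.
pose N := [set e in M | [disjoint e & K]].
have sNM : N \subset M by apply/subsetP => e; rewrite inE => /andP [].
have sNG := subset_trans sNM sMG; have tN := trivIsetS sNM tM.
have M_le : #|M|%:R <= #|N|%:R + #|K|%:R :> R.
  by rewrite -natrD ler_nat trivIset_leq_card_avoid.
have dXK : [disjoint cover N & K].
  apply/pred0P => v; apply/negP => /= /andP [/bigcupP [e + ve]].
  by rewrite inE => /andP [_ /disjointFr /(_ ve) ->].
have cardX : #|cover N|%:R = 2 * #|N|%:R :> R.
  by rewrite (@card_cover_matching _ G) ?natrM // /matching sNG.
have degX : c * #|N|%:R <= \sum_(v in cover N) (deg H v)%:R.
  rewrite big_trivIset //= mulr_natr -sumr_const ler_sum // => e eN.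
  have [u [v [uv eE]]] := simple_edgeP sG (subsetP sNG _ eN).
  rewrite eE big_setU1 ?inE //= big_set1 lower -?eE ?(subsetP sNG) //.
  apply/negP => /(vcoverP _ _ cK) [w we].
  by move: eN; rewrite inE => /andP [_ /disjointFr /(_ we) ->].
have b0 : 0 <= b by lra.
have sum_le := sum_deg_vcover_le (simple_graphS sHG sG) cK dXK upper b0.
rewrite cardX in sum_le.
have := ler0n R #|N|; have := ler0n R #|K|.
move: #|N|%:R #|K|%:R #|M|%:R M_le degX sum_le => n k m M_le degX sum_le k0.
rewrite le_eqVlt => /predU1P [n0|n0]; first nra.
have : c * n * (2 * n + k) <= b * (2 * n) * k.
  by apply: le_trans sum_le; rewrite ler_wpM2r //; lra.
have -> : c * n * (2 * n + k) = n * (c * (2 * n + k)) by ring.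
have -> : b * (2 * n) * k = n * (b * 2 * k) by ring.
rewrite ler_pM2l // => cnk; have : c * m <= c * (n + k) by rewrite ler_pM2l.
lra.
Qed.

Lemma bipartite_edcs_MM_le side (b c : R) G H :
  simple_graph G -> bipartite side G -> edcs b c G H -> 0 < c -> c <= 2 * b ->
  2 * c * (MM G)%:R <= (2 * b + c) * (MM H)%:R.
Proof.
move=> sG bip eH c0 cb; have sHG := edcs_sub eH.
have [M mM <-] := maximum_matching G.
have [K cK K_le] := konig (simple_graphS sHG sG) (bipartiteS sHG bip).
apply: (@le_trans _ _ ((2 * b + c) * #|K|%:R)); last first.
  by rewrite ler_wpM2l ?ler_nat //; lra.
have := edcs_matching_le_vcover sG eH mM cK c0 cb; lra.
Qed.

End BipartiteEdcs.

(** * Random bipartitions *)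

Section Cross.
Variables (R : realType) (V : finType).
Implicit Types (G H M : {set {set V}}) (side : pred V) (u v : V).

Definition cross side H : {set {set V}} :=
  [set e in H | [exists u in e, exists v in e, side u != side v]].

Lemma cross_sub side H : cross side H \subset H.
Proof. by apply/subsetP => e; rewrite inE => /andP []. Qed.

Lemma in_cross side H u v :
  ([set u; v] \in cross side H) = ([set u; v] \in H) && (side u != side v).
Proof.
rewrite inE; congr (_ && _); apply/exists_inP/idP => [[a]|uv].
  rewrite !inE => a_uv /exists_inP [b]; rewrite !inE => b_uv.
  by case/orP: a_uv b_uv => /eqP -> /orP [] /eqP ->; rewrite ?eqxx // eq_sym.
by exists u; rewrite ?set21 //; apply/exists_inP; exists v; rewrite ?set22.
Qed.

Lemma cross_bipartite side H : bipartite side (cross side H).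
Proof. by move=> u v; rewrite in_cross => /andP []. Qed.

Lemma matching_cross side G M : simple_graph G -> bipartite side M ->
  matching G M -> matching (cross side G) M.
Proof.
move=> sG bip /andP [/subsetP sMG tM]; rewrite /matching tM andbT.
apply/subsetP => e eM; have [u [v [_ eE]]] := simple_edgeP sG (sMG _ eM).
by rewrite eE in eM *; rewrite in_cross sMG //= bip.
Qed.

Lemma deg_cross side H v : simple_graph H ->
  2 * (deg (cross side H) v)%:R - (deg H v)%:R =
  - (-1) ^+ side v * \sum_u ([set v; u] \in H)%:R * (-1) ^+ side u :> R.
Proof.
move=> sH; rewrite !deg_sum_adj ?(simple_graphS (cross_sub _ _) sH) //.
rewrite !natr_sum !mulr_sumr -sumrB; apply: eq_bigr => u _; rewrite in_cross.
case: (_ \in H); case: (side u); case: (side v) => /=;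
  by rewrite ?expr0 ?expr1; ring.
Qed.

Lemma edcs_cross side (b c s : R) G H : edcs b c G H ->
  (forall v, `|2 * (deg (cross side H) v)%:R - (deg H v)%:R| <= s) ->
  edcs (b / 2 + s) (c / 2 - s) (cross side G) (cross side H).
Proof.
move=> /edcsP [sHG upper lower] half; apply/edcsP; split=> [|u v|u v].
- by rewrite /cross !setIdE setSI.
- rewrite in_cross => /andP [/upper uv _].
  have := half u; have := half v; rewrite !ler_norml.
  by move=> /andP [_ hv] /andP [_ hu]; lra.
- rewrite !in_cross => /andP [/lower + ->]; rewrite andbT => /[apply] uv.
  have := half u; have := half v; rewrite !ler_norml.
  by move=> /andP [hv _] /andP [hu _]; lra.
Qed.

End Cross.

Section MatchedBipartition.
Variables (R : realType) (V : finType) (G M : {set {set V}}).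
Hypotheses (sG : simple_graph G) (mM : matching G M).
Implicit Types (H : {set {set V}}) (u v w : V).

(* One of the two ends of the edge of [M] at [u], the same for both ends, and
   [u] itself when [M] does not cover [u]. *)
Definition mate_rep u : V := odflt u [pick x in pblock M u].

Lemma mate_rep_edge u : mate_rep u != u -> [set mate_rep u; u] \in M.
Proof.
have [/subsetP sMG tM] := andP mM.
rewrite /mate_rep; case: pickP => [x xu|_]; last by rewrite eqxx.
have [B BM uB] : exists2 B, B \in M & u \in B.
  apply/bigcupP; rewrite -mem_pblock; move: xu; rewrite /pblock.
  by case: pickP => [B /andP []|_]; rewrite ?inE.
rewrite /= => xneu; rewrite (def_pblock tM BM uB) in xu.
by rewrite -(simple_edge_eq sG (sMG _ BM) xu uB xneu).
Qed.

Lemma mate_rep_pair u v : [set u; v] \in M ->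
  mate_rep u = mate_rep v /\ mate_rep u \in [set u; v].
Proof.
have [_ tM] := andP mM => uvM; rewrite /mate_rep.
rewrite (def_pblock tM uvM (set21 _ _)) (def_pblock tM uvM (set22 _ _)).
by case: pickP => [x|/(_ u)] //=; rewrite set21.
Qed.

Definition fibre_sum (a : pred V) w : R :=
  \sum_(u | mate_rep u == w) (a u)%:R * (-1) ^+ (mate_rep u != u).

(* A fibre of [mate_rep] has at most two elements, with opposite signs. *)
Lemma sqr_fibre_sum_le (a : pred V) w :
  fibre_sum a w ^+ 2 <= \sum_(u | mate_rep u == w) (a u)%:R.
Proof.
pose y := (\sum_(u | (mate_rep u == w) && (u != w)) a u)%N.
have y1 : (y <= 1)%N.
  have sM := simple_graphS (proj1 (andP mM)) sG.
  apply: leq_trans (deg_matching_le1 w mM); rewrite deg_sum_adj //.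
  rewrite /y big_mkcond; apply: leq_sum => u _.
  case: ifP => // /andP [/eqP rw uw].
  by have := @mate_rep_edge u; rewrite rw eq_sym => -> //; case: (a u).
pose x : bool := (mate_rep w == w) && a w.
have -> : \sum_(u | mate_rep u == w) (a u)%:R = x%:R + y%:R :> R.
  rewrite (bigID (pred1 w)) big_andbC big_mkcondr big_pred1_eq natr_sum /x.
  by case: eqP.
have -> : fibre_sum a w = x%:R - y%:R.
  rewrite /fibre_sum (bigID (pred1 w)) big_andbC big_mkcondr big_pred1_eq.
  congr (_ + _); first by rewrite /x; case: eqP => //= _; rewrite mulr1.
  rewrite natr_sum -sumrN; apply: eq_bigr => u /andP [/eqP -> uw].
  by rewrite eq_sym uw expr1 mulrN1.
by case: x; case: y y1 => [|[|]] //= _; lra.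
Qed.

Lemma exists_balanced_bipartition H (D s : R) :
  simple_graph H -> (forall v, (deg H v)%:R <= D) -> 0 < D -> 0 < s ->
  2 * #|V|%:R * expR (- (s ^+ 2 / (8 * D))) < 1 ->
  exists2 side, bipartite side M
  & forall v, `|2 * (deg (cross side H) v)%:R - (deg H v)%:R| <= s.
Proof.
move=> sH degD D0 s0 small.
pose c v w := fibre_sum (fun u => [set v; u] \in H) w.
have cD v : \sum_w c v w ^+ 2 <= D.
  apply: le_trans (degD v); rewrite deg_sum_adj // natr_sum.
  rewrite [leRHS](partition_big mate_rep predT) //=.
  by apply: ler_sum => w _; apply: sqr_fibre_sum_le.
have [b b_le] := exists_balanced_signs D0 s0 cD small.
exists (fun u => b (mate_rep u) (+) (mate_rep u != u)) => [u v uvM|v].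
  have [ruv] := mate_rep_pair uvM.
  have uv := simple_edge_neq sG (subsetP (proj1 (andP mM)) _ uvM).
  rewrite -ruv !inE => /orP [] /eqP ->; first by rewrite eqxx uv; case: (b u).
  by rewrite eqxx [v == u]eq_sym uv; case: (b v).
rewrite deg_cross // normrM normrN normr_sign mul1r.
rewrite (partition_big mate_rep predT) //=; apply: le_trans (b_le v).
rewrite le_eqVlt; apply/predU1P; left; congr `|_|; apply: eq_bigr => w _.
rewrite /c /fibre_sum mulr_suml; apply: eq_bigr => u /eqP <-.
by rewrite signr_addb mulrA mulrAC.
Qed.

End MatchedBipartition.

Lemma edcs_MM_le (R : realType) (V : finType) (b r : R) (G H : {set {set V}}) :
  simple_graph G -> 0 < b -> 0 < r -> r < 1 / 2 ->
  2 * #|V|%:R * expR (- (r ^+ 2 * b / 64)) < 1 ->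
  edcs ((1 + r) * b) ((1 - r) * b) G H ->
  2 * (1 - 2 * r) * (MM G)%:R <= (3 + 2 * r) * (MM H)%:R.
Proof.
move=> sG b0 r0 r2 small eH; have sHG := edcs_sub eH.
have [M mM M_max] := maximum_matching G.
have [rb0 rb] : 0 < r * b / 2 /\ (1 + r) * b <= 2 * b.
  by rewrite divr_gt0 ?mulr_gt0 // ler_pM2r //; lra.
have deg_le v : (deg H v)%:R <= 2 * b.
  by apply: le_trans rb; apply: edcs_deg_le sG _ eH; rewrite mulr_ge0; lra.
have [||side bipM half] := exists_balanced_bipartition sG mM
  (simple_graphS sHG sG) deg_le _ rb0; first lra.
  by rewrite (_ : _ / _ = r ^+ 2 * b / 64) //; field; rewrite gt_eqF.
have MM_cross : MM G = MM (cross side G).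
  apply/eqP; rewrite eqn_leq (MMS (cross_sub side G)) andbT -M_max.
  exact: leq_card_MM (matching_cross sG bipM mM).
have c0 : 0 < (1 - r) * b / 2 - r * b / 2.
  have -> : (1 - r) * b / 2 - r * b / 2 = (1 - 2 * r) * b / 2 by ring.
  by rewrite divr_gt0 // mulr_gt0 //; lra.
have cb : (1 - r) * b / 2 - r * b / 2 <= 2 * ((1 + r) * b / 2 + r * b / 2).
  lra.
have := bipartite_edcs_MM_le (simple_graphS (cross_sub side G) sG)
  (@cross_bipartite _ side G) (edcs_cross eH half) c0 cb.
rewrite -MM_cross => bound.
have MM_le : (3 + 2 * r) * (MM (cross side H))%:R <= (3 + 2 * r) * (MM H)%:R.
  by rewrite ler_wpM2l ?ler_nat ?MMS ?cross_sub //; lra.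
apply: le_trans MM_le; rewrite -(ler_pM2l b0); lra.
Qed.

(** * Random edge partitions *)

Lemma Pr_kpartitionE (R : realType) (V : finType) (k : nat) (G : {set {set V}})
  (A : pred (kassign k G)) : Pr_kpartition R A = prob R A.
Proof.
rewrite /Pr_kpartition /prob /mean mulr_suml big_mkcond; apply: eq_bigr => f _.
rewrite prodr_const card_ffun card_ord natrX exprVn.
by case: (A f); rewrite ?mul1r ?mul0r.
Qed.

Section RandomPartition.
Variables (V : finType) (k : nat) (G : {set {set V}}).
Implicit Types (H : {set {set V}}) (f : kassign k G) (i : 'I_k) (v : V).

Local Notation edge := {e : {set V} | e \in G}.

Lemma card_kassign_gt0 : (0 < k)%N -> (0 < #|{: kassign k G}|)%N.
Proof. by move=> k0; rewrite card_ffun card_ord expn_gt0 k0. Qed.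

Lemma in_part f i (x : edge) : (val x \in part f i) = (f x == i).
Proof.
apply/imsetP/idP => [[y]|fx]; last by exists x; rewrite ?inE.
by rewrite !inE => fy /val_inj ->.
Qed.

Lemma part_sub f i : part f i \subset G.
Proof. by apply/subsetP => e /imsetP [x _ ->]; apply: valP. Qed.

Lemma part_disjoint f i j : i != j -> [disjoint part f i & part f j].
Proof.
move=> ij; apply/pred0P => e; apply/negP => /andP [] /imsetP [x].
by rewrite inE => /eqP fx -> /=; rewrite in_part fx (negbTE ij).
Qed.

Lemma bigcup_part f : \bigcup_i part f i = G.
Proof.
apply/eqP; rewrite eqEsubset; apply/andP; split.
  by apply/bigcupsP => i _; apply: part_sub.
apply/subsetP => e eG; apply/bigcupP; exists (f (exist _ e eG)) => //.
by have := in_part f (f (exist _ e eG)) (exist _ e eG); rewrite eqxx => ->.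
Qed.

Definition incident H v : {set edge} :=
  [set x | (val x \in H) && (v \in val x)].

Lemma deg_part H f i v : deg (H :&: part f i) v = load (incident H v) i f.
Proof.
rewrite /deg /load -[RHS](card_imset _ val_inj); apply: eq_card => e.
rewrite !inE.
apply/idP/imsetP => [/andP [/andP [eH /imsetP [x]]]|[x]]; rewrite !inE.
  by move=> fx ex ve; exists x; rewrite ?inE // -ex eH ve.
by case/andP => /andP [xH vx] fx ->; rewrite xH vx in_part fx.
Qed.

Lemma card_incident H v : H \subset G -> #|incident H v| = deg H v.
Proof.
move=> sHG; rewrite /deg -[LHS](card_imset _ val_inj); apply: eq_card => e.
apply/imsetP/idP => [[x]|]; rewrite !inE; first by move=> xH ->.
case/andP => eH ve.
by exists (exist _ e (subsetP sHG _ eH)); rewrite ?inE //= eH.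
Qed.

Definition near_uniform (R : realType) f H (s : R) : bool :=
  [forall v, forall i,
    `|(deg (H :&: part f i) v)%:R - (deg H v)%:R / k%:R| <= s].

Lemma near_uniformP (R : realType) f H (s : R) :
  reflect
    (forall v i, `|(deg (H :&: part f i) v)%:R - (deg H v)%:R / k%:R| <= s)
    (near_uniform f H s).
Proof. by apply: (iffP forallP) => near v; apply/forallP. Qed.

Lemma prob_not_near_uniform_le (R : realType) H (D g : R) :
  (0 < k)%N -> simple_graph H -> H \subset G ->
  0 < g -> g <= 2 * D -> 8 * D <= g ^+ 2 ->
  (forall v, (deg H v)%:R <= k%:R * D) ->
  prob R (fun f => ~~ near_uniform f H g) <=
  4 * #|V|%:R ^+ 2 * expR (- (g ^+ 2 / (8 * D))).
Proof.
move=> k0 sH sHG g0 gD Dg degD; set tail := expR _.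
pose far v f := [exists i,
  g <= `|(deg (H :&: part f i) v)%:R - (deg H v)%:R / k%:R|].
have far_le v : prob R (far v) <= 4 * #|V|%:R * tail.
  have loadD : #|incident H v|%:R / #|'I_k|%:R <= D.
    by rewrite card_ord card_incident // ler_pdivrMr ?ltr0n // mulrC degD.
  have I_gt0 : (0 < #|'I_k|)%N by rewrite card_ord.
  apply: le_trans (le_prob R _) (le_trans
    (prob_exists_load_dev_ge I_gt0 g0 gD Dg loadD) _).
    move=> f; rewrite card_ord card_incident // => /existsP [i far_i].
    by apply/existsP; exists i; rewrite -deg_part.
  rewrite card_incident // ler_wpM2r ?expR_ge0 // ler_wpM2l // ler_nat.
  exact: deg_le_card.
apply: le_trans (le_prob R _) (le_trans (prob_exists_le R far) _).
  move=> f; rewrite negb_forall => /existsP [v]; rewrite negb_forall.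
  case/existsP => i; rewrite -ltNge => /ltW far_i.
  by apply/existsP; exists v; apply/existsP; exists i.
apply: le_trans (ler_sum _ (fun v _ => far_le v)) _.
rewrite sumr_const -[_ *+ _]mulr_natl; lra.
Qed.

End RandomPartition.

Section UnionOfEdcs.
Variables (R : realType) (V : finType).
Implicit Types (G H P : {set {set V}}) (u v : V).

Lemma edcs_setI (b c m s : R) G H P : 0 < m -> edcs b c G H -> P \subset G ->
  (forall v, `|(deg (H :&: P) v)%:R - (deg H v)%:R / m| <= s) ->
  edcs (b / m + 2 * s) (c / m - 2 * s) P (H :&: P).
Proof.
move=> m0 /edcsP [_ upper lower] /subsetP sPG near.
apply/edcsP; split=> [|u v|u v]; first exact: subsetIr.
- rewrite inE => /andP [/upper uv _].
  have : ((deg H u)%:R + (deg H v)%:R) / m <= b / m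
    by rewrite ler_pM2r ?invr_gt0.
  rewrite mulrDl; have := near u; have := near v; rewrite !ler_norml.
  by move=> /andP [_ nv] /andP [_ nu]; lra.
- move=> uvP; rewrite inE uvP andbT => /(lower _ _ (sPG _ uvP)) uv.
  have : c / m <= ((deg H u)%:R + (deg H v)%:R) / m
    by rewrite ler_pM2r ?invr_gt0.
  rewrite mulrDl; have := near u; have := near v; rewrite !ler_norml.
  by move=> /andP [nv _] /andP [nu _]; lra.
Qed.

Lemma edcs_bigcup (I : finType) (b c s : R) (m : V -> R)
    (G C : I -> {set {set V}}) :
  (forall i j, i != j -> [disjoint G i & G j]) ->
  (forall i, edcs b c (G i) (C i)) ->
  (forall v i, `|(deg (C i) v)%:R - m v| <= s) ->
  edcs (#|I|%:R * (b + 4 * s)) (#|I|%:R * (c - 4 * s))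
    (\bigcup_i G i) (\bigcup_i C i).
Proof.
move=> disjG eC near; have sCG i := edcs_sub (eC i).
have disjC i j : i != j -> [disjoint C i & C j].
  by move=> /disjG; apply: disjointW; apply: sCG.
have nearU v i :
    `|(deg (\bigcup_i C i) v)%:R - #|I|%:R * (deg (C i) v)%:R| <=
    #|I|%:R * (2 * s) :> R.
  have cst (x : R) : #|I|%:R * x = \sum_(i : I) x
    by rewrite sumr_const mulr_natl.
  rewrite deg_bigcup // natr_sum !cst -sumrB.
  apply: le_trans (ler_norm_sum _ _ _) (ler_sum _ _) => j _.
  have := near v i; have := near v j; rewrite !ler_norml.
  by move=> /andP [nj nj'] /andP [ni ni']; apply/andP; split; lra.
have nat_mul_le (x y : R) : x <= y -> #|I|%:R * x <= #|I|%:R * y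
  by apply: ler_wpM2l.
apply/edcsP; split=> [|u v|u v].
- by apply/bigcupsP => i _; apply: subset_trans (sCG i) (bigcup_sup i _).
- case/bigcupP => i _ uvC; have /edcsP [_ /(_ _ _ uvC) /nat_mul_le + _] := eC i.
  have := nearU u i; have := nearU v i; rewrite !ler_norml.
  by move=> /andP [_ nv] /andP [_ nu]; lra.
- case/bigcupP => i _ uvG uvU; have uvC : [set u; v] \notin C i.
    by apply: contraNN uvU => uvC; apply/bigcupP; exists i.
  have /edcsP [_ _ /(_ _ _ uvG uvC) /nat_mul_le] := eC i.
  have := nearU u i; have := nearU v i; rewrite !ler_norml.
  by move=> /andP [nv _] /andP [nu _]; lra.
Qed.

End UnionOfEdcs.

(** * The coreset *)

Section PartitionedEdcs.
Variables (R : realType) (V : finType) (k : nat) (G : {set {set V}}).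
Hypotheses (k0 : (0 < k)%N) (sG : simple_graph G).
Implicit Types (H : {set {set V}}) (f : kassign k G).
Implicit Types (C : 'I_k -> {set {set V}}).

(* Both [H :&: part f i] and [C i] are EDCSs of [part f i], so they have close
   degrees. *)
Lemma edcs_bigcup_part (b s h : R) H f C : 0 < b -> 2 <= s -> 0 < h ->
  2 * ln #|V|%:R * (b + s) * (2 * s) <= h ^+ 2 ->
  edcs (k%:R * b + 1) (k%:R * b - 1) G H -> near_uniform f H (s / 4) ->
  (forall i, edcs b (b - s) (part f i) (C i)) ->
  edcs (k%:R * (b + (8 * h + 10 * s))) (k%:R * (b - (8 * h + 10 * s))) G
    (\bigcup_i C i).
Proof.
move=> b0 s2 h0 hs eH /near_uniformP near eC.
have kR : 0 < k%:R :> R by rewrite ltr0n.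
have k1 : k%:R^-1 <= 1 :> R by rewrite invf_le1 // ler1n.
have eHpart i : edcs (b + s) (b - s) (part f i) (H :&: part f i).
  apply: edcsW (edcs_setI kR eH (part_sub f i) (near^~ i)).
    by rewrite mulrDl mulrAC mulfV ?gt_eqF //; lra.
  by rewrite mulrBl mulrAC mulfV ?gt_eqF //; lra.
have eC' i : edcs (b + s) (b - s) (part f i) (C i) by apply: edcsW (eC i); lra.
have sE : b + s - (b - s) = 2 * s by ring.
have [bs0 bs_le] : 0 < b + s /\ b - s <= b + s by split; lra.
rewrite -[2 * s]sE in hs.
have degC v i :
    `|(deg (C i) v)%:R - (deg H v)%:R / k%:R| <= 2 * h + 2 * s + s / 4.
  have := edcs_deg_gap_le (simple_graphS (part_sub f i) sG) bs0 bs_le h0 v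
    (eC' i) (eHpart i) hs.
  have := near v i; rewrite sE /deg_gap !ler_norml.
  by move=> /andP [n1 n2] /andP [g1 g2]; apply/andP; split; lra.
have := edcs_bigcup (part_disjoint f) eC degC; rewrite bigcup_part card_ord.
by apply: edcsW; rewrite ler_pM2l //; lra.
Qed.

(* The first bound keeps the degree slack of the union below [eps / 8], the
   second one the failure probability of the random partition below [n ^- d]. *)
Definition admissible (d : nat) (eps lam b : R) : Prop :=
  [/\ 0 < lam, lam * ln #|V|%:R <= 2 * (eps / 512) ^+ 2
    & (d%:R + 4) * ln #|V|%:R <= lam ^+ 2 * b / 256].

Variables (d : nat) (eps lam b : R).
Hypotheses (V1 : (1 < #|V|)%N) (eps01 : 0 < eps < 1).
Hypothesis adm : admissible d eps lam b.

Lemma admissible_slack_le : lam <= eps / 160.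
Proof.
have [/andP [eps0 eps1] [lam0 lamL _]] := (eps01, adm).
have : lam * (1 / 2) <= lam * ln #|V|%:R by rewrite ler_pM2l // ln_nat_ge_half.
have : eps ^+ 2 <= eps by rewrite expr2 ler_piMr // ltW.
move: lamL; lra.
Qed.

Lemma admissible_exponent_ge :
  2 <= lam ^+ 2 * b / 256 /\ 4 * ln #|V|%:R <= lam ^+ 2 * b / 256.
Proof.
have [_ _ lam_b] := adm; have L_ge := ln_nat_ge_half R V1.
have : 0 <= d%:R * ln #|V|%:R :> R by rewrite mulr_ge0 ?ln_nat_ge0.
by split; lra.
Qed.

Lemma admissible_degree_slack_ge : 512 <= lam * b.
Proof.
have [/andP [eps0 eps1] [lam0 _ _]] := (eps01, adm).
have lam_lam_b : 512 <= lam * (lam * b).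
  by rewrite mulrA -expr2; have [+ _] := admissible_exponent_ge; lra.
have lam_b_ge0 : 0 <= lam * b by rewrite -(pmulr_rge0 _ lam0); lra.
apply: le_trans lam_lam_b (ler_piMl lam_b_ge0 _).
by have := admissible_slack_le; lra.
Qed.

Lemma admissible_degree_gt0 : 0 < b.
Proof.
have [lam0 _ _] := adm; rewrite -(pmulr_rgt0 _ lam0).
exact: lt_le_trans admissible_degree_slack_ge.
Qed.

Lemma edcs_bigcup_admissible H f C :
  edcs (k%:R * b + 1) (k%:R * b - 1) G H -> near_uniform f H (lam * b / 4) ->
  (forall i, edcs b ((1 - lam) * b) (part f i) (C i)) ->
  edcs ((1 + eps / 8) * (k%:R * b)) ((1 - eps / 8) * (k%:R * b)) G
    (\bigcup_i C i).
Proof.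
have [/andP [eps0 eps1] [lam0 lamL _]] := (eps01, adm).
have b0 := admissible_degree_gt0; have kR : 0 < k%:R :> R by rewrite ltr0n.
have s_le : lam * b <= eps / 160 * b by rewrite ler_pM2r // admissible_slack_le.
have eb : eps * b <= b by rewrite ler_piMl // ltW.
have s2 : 2 <= lam * b by have := admissible_degree_slack_ge; lra.
have h0 : 0 < eps * b / 128 by rewrite divr_gt0 ?mulr_gt0.
have h_sqr : 2 * ln #|V|%:R * (b + lam * b) * (2 * (lam * b)) <=
    (eps * b / 128) ^+ 2.
  have -> : (eps * b / 128) ^+ 2 = 2 * (eps / 512) ^+ 2 * (8 * b ^+ 2) by field.
  apply: (@le_trans _ _ (lam * ln #|V|%:R * (8 * b ^+ 2))); last first.
    by rewrite ler_wpM2r // mulr_ge0 ?sqr_ge0.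
  have : lam * ln #|V|%:R * b * (lam * b) <= lam * ln #|V|%:R * b * b.
    by rewrite ler_wpM2l ?mulr_ge0 ?ln_nat_ge0 ?(ltW lam0) ?(ltW b0) //; lra.
  lra.
move=> eH near eC; have eC' i : edcs b (b - lam * b) (part f i) (C i).
  by have := eC i; rewrite mulrBl mul1r.
apply: edcsW (edcs_bigcup_part b0 s2 h0 h_sqr eH near eC').
  by rewrite [leRHS]mulrCA ler_pM2l //; lra.
by rewrite [leLHS]mulrCA ler_pM2l //; lra.
Qed.

Lemma admissible_bipartition_tail :
  2 * #|V|%:R * expR (- ((eps / 8) ^+ 2 * (k%:R * b) / 64)) < 1.
Proof.
have [/andP [eps0 eps1] [lam0 _ _]] := (eps01, adm).
have b0 := admissible_degree_gt0.
have V0 : 0 < #|V|%:R :> R by rewrite ltr0n ltnW.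
set tail := expR _; apply: (@le_lt_trans _ _ (#|V|%:R ^+ 2 * tail)).
  by rewrite ler_wpM2r ?expR_ge0 // expr2 ler_wpM2r // ler_nat.
rewrite -(expR_natr_mul_ln _ V0) -expRD expR_lt1.
have lam_eps : lam ^+ 2 <= (eps / 4) ^+ 2.
  by rewrite lerXn2r ?nnegrE; have := admissible_slack_le; lra.
have b_kb : b <= k%:R * b by rewrite ler_peMl ?ler1n // ltW.
have := ler_pM (sqr_ge0 lam) (ltW b0) lam_eps b_kb.
by have := ln_nat_ge_half R V1; have [_] := admissible_exponent_ge; lra.
Qed.

Lemma MM_bigcup_admissible H f C :
  edcs (k%:R * b + 1) (k%:R * b - 1) G H -> near_uniform f H (lam * b / 4) ->
  (forall i, edcs b ((1 - lam) * b) (part f i) (C i)) ->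
  (MM G)%:R / (3 / 2 + eps) <= (MM (\bigcup_i C i))%:R :> R.
Proof.
have [eps0 eps1] := andP eps01; move=> eH near eC.
have kb0 : 0 < k%:R * b by rewrite mulr_gt0 ?ltr0n // admissible_degree_gt0.
have [r0 r2] : 0 < eps / 8 /\ eps / 8 < 1 / 2 by split; lra.
have := edcs_MM_le sG kb0 r0 r2 admissible_bipartition_tail
  (edcs_bigcup_admissible eH near eC).
rewrite ler_pdivrMr; last lra.
set m := (MM G)%:R; set c : R := (MM _)%:R => mc.
have ec : 0 <= eps * c by rewrite mulr_ge0 // ltW.
have ece : eps * c * eps <= eps * c by rewrite ler_piMr // ltW.
by rewrite -(@ler_pM2l _ (2 * (1 - 2 * (eps / 8)))); lra.
Qed.

Lemma prob_near_uniform_ge H : edcs (k%:R * b + 1) (k%:R * b - 1) G H ->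
  1 - #|V|%:R ^- d <= prob R (fun f => near_uniform f H (lam * b / 4)).
Proof.
have [/andP [eps0 eps1] [lam0 _ lam_b]] := (eps01, adm).
have b0 := admissible_degree_gt0.
have V0 : 0 < #|V|%:R :> R by rewrite ltr0n ltnW.
move=> eH; have sHG := edcs_sub eH.
have s_b : lam * b <= b.
  by rewrite ler_piMl ?(ltW b0) //; have := admissible_slack_le; lra.
have s_ge := admissible_degree_slack_ge.
have kb : 1 <= k%:R * b by rewrite -[leLHS]mulr1 ler_pM ?ler1n //; lra.
have degH v : (deg H v)%:R <= k%:R * (2 * b).
  by apply: le_trans (edcs_deg_le v sG _ eH) _; lra.
have tailE : (lam * b / 4) ^+ 2 / (8 * (2 * b)) = lam ^+ 2 * b / 256.
  by field; rewrite gt_eqF.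
have [g0 gD] : 0 < lam * b / 4 /\ lam * b / 4 <= 2 * (2 * b) by split; lra.
have Dg : 8 * (2 * b) <= (lam * b / 4) ^+ 2.
  have D0 : 0 < 8 * (2 * b) by lra.
  rewrite -[leLHS]mul1r -ler_pdivlMr // tailE.
  by have [+ _] := admissible_exponent_ge; lra.
have := prob_not_near_uniform_le k0 (simple_graphS sHG sG) sHG g0 gD Dg degH.
rewrite (probC R (card_kassign_gt0 G k0)) tailE => far_le.
rewrite lerBlDr -lerBlDl.
apply: le_trans far_le _; set tail := expR _.
apply: (@le_trans _ _ (#|V|%:R ^+ 4 * tail)).
  rewrite ler_wpM2r ?expR_ge0 // [#|V|%:R ^+ 4](exprD _ 2 2).
  by rewrite ler_wpM2r ?sqr_ge0 // -natrX ler_nat (leq_mul V1 V1).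
rewrite -!(expR_natr_mul_ln _ V0) -expRN -expRD ler_expR; lra.
Qed.

End PartitionedEdcs.

Section EdcsCoreset.
Variables (R : realType) (V : finType) (k : nat).

Lemma edcs_coreset_size_le (b c : R) : 0 <= b ->
  coreset_size_le (edcs b c : rel {set {set V}}) (#|V|%:R * b).
Proof. by move=> b0 G C sG; apply: edcs_card_le. Qed.

Lemma edcs_coreset_card_le1 (alpha delta b c : R) :
  (0 < k)%N -> (#|V| <= 1)%N -> 0 <= delta ->
  randomized_composable_coreset k alpha delta (edcs b c : rel {set {set V}}).
Proof.
move=> k0 V1 delta0.
split=> [G /(simple_graph_set0 V1) ->|G C _|G /(simple_graph_set0 V1) G0].
- by exists set0; apply/edcsP; split=> // u v; rewrite inE.
- exact: edcs_sub.
rewrite Pr_kpartitionE; apply: (@le_trans _ _ 1); first by rewrite gerBl.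
rewrite -[leLHS](mean_cst (card_kassign_gt0 G k0)); apply: le_mean => f.
rewrite ler1n lt0b; apply/forallP => C; apply/implyP => _.
by rewrite G0 MM_set0 mul0r.
Qed.

Lemma edcs_coreset (d : nat) (eps lam b : R) :
  (0 < k)%N -> (1 < #|V|)%N -> 0 < eps < 1 -> admissible V d eps lam b ->
  randomized_composable_coreset k (3 / 2 + eps) (#|V|%:R ^- d)
    (edcs b ((1 - lam) * b) : rel {set {set V}}).
Proof.
move=> k0 V1 eps01 adm; split=> [G sG|G C _|G sG].
- have [C eC] := edcs_exists (b - 1) sG; exists C; apply: edcsW eC; first lra.
  by have := admissible_degree_slack_ge V1 eps01 adm; lra.
- exact: edcs_sub.
have [H eH] := edcs_exists (k%:R * b) sG; rewrite Pr_kpartitionE.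
apply: le_trans (prob_near_uniform_ge k0 sG V1 eps01 adm eH) _.
apply: le_prob => f near; apply/forallP => C; apply/implyP => /forallP eC.
exact: (MM_bigcup_admissible k0 sG V1 eps01 adm eH near eC).
Qed.

End EdcsCoreset.

Section CoresetConstants.
Variables (R : realType) (d : nat).

Definition slack_const : R := 512 ^- 2.

Definition degree_const : R := 1024 * (d%:R + 4) / slack_const ^+ 2.

Lemma slack_const_gt0 : 0 < slack_const.
Proof. by rewrite invr_gt0 exprn_gt0. Qed.

Lemma degree_const_gt0 : 0 < degree_const.
Proof.
by rewrite divr_gt0 ?exprn_gt0 ?slack_const_gt0 // mulr_gt0 // ltr_wpDl.
Qed.

Lemma degree_bound_ge0 (n : nat) (eps : R) : 0 < eps ->
  0 <= degree_const * eps ^- 6 * ln n%:R ^+ 7.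
Proof.
move=> eps0; rewrite mulr_ge0 ?exprn_ge0 ?ln_nat_ge0 //.
by rewrite ltW // divr_gt0 ?degree_const_gt0 ?exprn_gt0.
Qed.

Lemma const_admissible (V : finType) (eps : R) :
  (1 < #|V|)%N -> 0 < eps < 1 ->
  admissible V d eps (slack_const * (eps / ln #|V|%:R) ^+ 2)
    (degree_const * eps ^- 6 * ln #|V|%:R ^+ 7).
Proof.
move=> V1 /andP [eps0 eps1]; have := ln_nat_ge_half R V1.
rewrite /admissible; set L := ln _ => L_ge.
have cl0 := slack_const_gt0; have L0 : 0 < L by lra.
split; first by rewrite mulr_gt0 // exprn_gt0 // divr_gt0.
  have -> : slack_const * (eps / L) ^+ 2 * L = L^-1 * (eps / 512) ^+ 2.
    by rewrite /slack_const; field; rewrite gt_eqF.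
  rewrite ler_wpM2r ?sqr_ge0 // -[leRHS]invrK lef_pV2 ?posrE ?invr_gt0 //.
  lra.
set lam_b := leRHS.
have -> : lam_b = (d%:R + 4) * L * ((2 * L) ^+ 2 * eps ^- 2).
  by rewrite /lam_b /degree_const; field; rewrite !gt_eqF.
have inv_eps : 1 <= eps ^- 2.
  by rewrite invf_ge1 ?exprn_gt0 // exprn_ile1 // ltW.
rewrite ler_peMr ?mulr_ge0 ?addr_ge0 ?(ltW L0) // -[leLHS]mulr1 ler_pM //.
by rewrite -[leLHS](expr1n _ 2) lerXn2r ?nnegrE //; lra.
Qed.

End CoresetConstants.

Theorem theorem5p2 (R : realType) (d : nat) :
  exists cl cb cs : R, [/\ 0 < cl, 0 < cb, 0 < cs &
    forall (V : finType) (k : nat) (eps : R),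
      (1 <= k)%N -> 0 < eps < 1 ->
      let n : R := #|V|%:R in
      let lambda := cl * (eps / ln n) ^+ 2 in
      let beta := cb * eps ^- 6 * ln n ^+ 7 in
      let ALG : rel {set {set V}} := edcs beta ((1 - lambda) * beta) in
      randomized_composable_coreset k (3 / 2 + eps) (n ^- d) ALG /\
      coreset_size_le ALG (cs * (n * beta))].
Proof.
exists (slack_const R), (degree_const R d), 1.
split=> [|||V k eps k0 eps01 n lambda beta ALG] //.
- exact: slack_const_gt0.
- exact: degree_const_gt0.
have /andP [eps0 _] := eps01; split; last first.
  by rewrite mul1r; apply: edcs_coreset_size_le (degree_bound_ge0 _ _ eps0).
have [V1|V1] := leqP #|V| 1.
  by apply: edcs_coreset_card_le1; rewrite // invr_ge0 exprn_ge0.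
by apply: edcs_coreset => //; apply: const_admissible.
Qed.
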